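(* Let $n\ge 2$, let $a_1,\dots,a_n>0$ be real numbers and let $w_1,\dots,w_n>0$ satisfy $\sum_{i=1}^n w_i=1$. Let $H_w=H_w(a_1,\dots,a_n)$ be the weighted harmonic mean, and set $$\bar x_i=w_i\frac{H_w}{a_i}\quad (i=1,\dots,n-1),\qquad \bar x_n=w_nH_w .$$ Consider in $\mathbb{R}^n$, with coordinates $(x_1,\dots,x_n)$, the hyperplane $\Pi$ through the points $P_1,\dots,P_n$, given by $$\Pi\equiv\; x_n=a_n+\sum_{i=1}^{n}x_i(a_i-a_n),$$ the hyperplane $V_n$ through the points $B_1,\dots,B_{n-1},P_n$, given by $$V_n\equiv\; \sum_{i=1}^{n-1}x_i+\frac{x_n}{a_n}=1,$$ and, for $i=1,\dots,n-1$, the paraboloid $V_i$ through $B_1,\dots,B_{i-1},P_i,B_{i+1},\dots,B_n$, given by $$V_i\equiv\; x_n=b_ix_i^2+(a_i-b_i)x_i,\qquad b_i=\frac{H_w}{\bar x_i(\bar x_i-1)}(w_n-w_i).$$ Then the system formed by the equation of $V_n$ and the equations of $V_1,\dots,V_{n-1}$ has a unique solution, namely $(\bar x_1,\dots,\bar x_n)$. Moreover: (a) The height of the prism through the point $(\bar x_1,\dots,\bar x_{n-1},0)$ coincides with the weighted harmonic mean $H_w$ of $a_1,\dots,a_n$; that is, the point $(\bar x_1,\dots,\bar x_{n-1},H_w)$ belongs to $\Pi$. (b) The height of the prism through the barycenter of the base $GM_w=\sum_{i=1}^n w_iB_i$ coincides with the weighted arithmetic mean $M_w=\sum_{i=1}^n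 w_ia_i$.
   Context: The weighted harmonic mean is $H_w(a_1,\dots,a_n)=\dfrac{1}{\sum_{i=1}^n w_i/a_i}$ and the weighted arithmetic mean is $M_w(a_1,\dots,a_n)=\sum_{i=1}^n w_ia_i$. Vertices of the prism in $\mathbb{R}^n$: for $i=1,\dots,n-1$, $B_i=(0,\dots,0,1,0,\dots,0)$ (with $1$ in position $i$) and $P_i=(0,\dots,0,1,0,\dots,0,a_i)$ (with $1$ in position $i$ and last coordinate $a_i$); $B_n=(0,\dots,0)$ and $P_n=(0,\dots,0,a_n)$. The $B_i$ are the vertices of the base (in $x_n=0$) and $P_i$ lies above $B_i$ at height $a_i$ in the direction of the $x_n$ axis. The height of the prism through a point $(p_1,\dots,p_{n-1},0)$ is the $x_n$-coordinate of the intersection of $\Pi$ with the line through that point parallel to the $x_n$ axis. The word ''paraboloid'' is used for the hypersurface given by the stated equation, including the degenerate case where the quadratic coefficient is zero.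
   Formalization: Uniqueness of the solution is claimed only inside the prism (convex hull of the B_i and P_i), not in all of R^n: for n=2, a=(1,1), w=(1/3,2/3) the system has both (1/3,2/3) and (2,-1) as solutions. *)

(* Defs.v *)
From mathcomp Require Import all_boot all_order all_algebra.
From mathcomp Require Import classical_sets reals.
Set Implicit Arguments.
Unset Strict Implicit.
Unset Printing Implicit Defensive.
Import Order.TTheory GRing.Theory Num.Theory.
Local Open Scope classical_set_scope.
Local Open Scope ring_scope.

(* The space is R^(n.+1), realised as 'rV[R]_n.+1.  The last coordinate is the
   one indexed by ord_max; the others are the indices i != ord_max. *)
Section Prism.
Context {R : realType} {n : nat}.
Implicit Types (a w : 'I_n.+1 -> R) (x p q : 'rV[R]_n.+1) (i : 'I_n.+1).

Definition hmean w a : R := 1 / \sum_i (w i / a i).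

Definition amean w a : R := \sum_i (w i * a i).

Definition vertical : 'rV[R]_n.+1 := delta_mx 0 ord_max.

Definition base_vertex i : 'rV[R]_n.+1 :=
  if i == ord_max then 0 else delta_mx 0 i.

Definition top_vertex a i : 'rV[R]_n.+1 := base_vertex i + a i *: vertical.

(* The convex hull of the vertices B_i and P_i. *)
Definition prism a : set 'rV[R]_n.+1 :=
  [set x | exists lam mu : 'I_n.+1 -> R,
    [/\ forall i, 0 <= lam i,
        forall i, 0 <= mu i,
        \sum_i (lam i + mu i) = 1
      & x = \sum_i (lam i *: base_vertex i + mu i *: top_vertex a i)]].

Definition xbar w a : 'rV[R]_n.+1 :=
  \row_i (if i == ord_max then w ord_max * hmean w a
          else w i * (hmean w a / a i)).

(* For weights as in the theorem and i != ord_max, 0 < xbar w a 0 i < 1, so the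
   denominator does not vanish. *)
Definition bcoef w a i : R :=
  hmean w a / (xbar w a 0 i * (xbar w a 0 i - 1)) * (w ord_max - w i).

(* The term of index ord_max in the sum is zero. *)
Definition Pi_hyperplane a : set 'rV[R]_n.+1 :=
  [set x | x 0 ord_max = a ord_max + \sum_i x 0 i * (a i - a ord_max)].

Definition Vlast a : set 'rV[R]_n.+1 :=
  [set x | \sum_(i | i != ord_max) x 0 i + x 0 ord_max / a ord_max = 1].

(* Meant for i != ord_max. *)
Definition Vparab w a i : set 'rV[R]_n.+1 :=
  [set x | x 0 ord_max
           = bcoef w a i * x 0 i ^+ 2 + (a i - bcoef w a i) * x 0 i].

(* When some w i <> w ord_max, this real system can also have solutions outside
   the prism.  Example: n.+1 = 2, a = (1, 1), w = (1/3, 2/3); the solutions are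
   xbar = (1/3, 2/3) and (2, -1).  Hence uniqueness is only claimed for
   Vsystem w a `&` prism a. *)
Definition Vsystem w a : set 'rV[R]_n.+1 :=
  [set x | Vlast a x /\ forall i, i != ord_max -> Vparab w a i x].

Definition set_last x (t : R) : 'rV[R]_n.+1 :=
  \row_i (if i == ord_max then t else x 0 i).

Definition vertical_line p : set 'rV[R]_n.+1 :=
  [set q | exists t : R, q = p + t *: vertical].

(* The vertical line through p meets the hyperplane in exactly one point, whose
   last coordinate is h. *)
Definition is_height a p (h : R) : Prop :=
  exists q, Pi_hyperplane a `&` vertical_line p = [set q] /\ q 0 ord_max = h.

Definition base_barycenter w : 'rV[R]_n.+1 := \sum_i w i *: base_vertex i.

End Prism.

(* Main.v *)
Require Import Defs.
From mathcomp Require Import all_boot all_order all_algebra.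
From mathcomp Require Import classical_sets reals.
From mathcomp Require Import ring lra.
Set Implicit Arguments.
Unset Strict Implicit.
Unset Printing Implicit Defensive.
Import Order.TTheory GRing.Theory Num.Theory.
Local Open Scope classical_set_scope.
Local Open Scope ring_scope.

(** The point of the theorem that is not a direct computation is uniqueness.
    Write [q(y) = y (1 - y)].  A point [x] of the prism lying on [V_n] is
    encoded by the numbers [s_i = x_i] for [i <> n] and [s_n = x_n / a_n]: they
    are nonnegative and the equation of [V_n] says that they sum to [1].  With
    [t = x_n], the remaining equations become [t = a_i s_i + c_i q(s_i)] with
    [c_i = - b_i], and the definition of [s_n] is the same equation with
    [c_n = 0].  All indices thus play the same role.

    Let [(s, t)] and [(s', t')] be two solutions with [0 <= t' <= t]
    and [0 < t], so that every [s_i] is positive.  Eliminating [c_i] gives, for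
    every [i],
      [t q(s'_i) - t' q(s_i) = a_i s_i s'_i (s_i - s'_i)]  ([two_solutions]),
    so, where [s'_i] is not zero, the sign of [s_i - s'_i] compares [t q(s'_i)]
    with [t' q(s_i)].  If [s_i < s'_i], this forces [q(s'_i) < q(s_i)], hence
    [s_i + s'_i > 1]; since both solutions have total mass [1], at most one
    index can decrease in this way.  If [i] is that index, all other
    coordinates satisfy [s'_k <= s_k] and [t' q(s_k) <= t q(s'_k)], which
    implies [t' s_k s_i <= t s'_k s'_i] ([cross_bound]).  Summing over [k <> i]
    yields [t' q(s_i) <= t q(s'_i)], against the strict inequality in the other
    direction at [i].  So no coordinate decreases, and as the sums agree the
    two solutions coincide ([simplex_solution_unique]).

    The solution itself has [s_i = w_i H / a_i], which sums to [1] by the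
    definition of [H]; the [b_i] are exactly the coefficients that make each
    paraboloid pass through it.  Its height is [\sum_i a_i s_i = H], because
    the height of the prism is the affine function with value [a_i] at
    [B_i]. *)

(** * Uniqueness on the simplex *)

Section SimplexUniqueness.
Context {R : realFieldType}.

(** The elimination of [c] between the equations of two solutions: it leaves a
    relation whose sign is that of [x - x']. *)
Lemma two_solutions (a c t t' x x' : R) :
  t = a * x + c * (x * (1 - x)) -> t' = a * x' + c * (x' * (1 - x')) ->
  t * (x' * (1 - x')) - t' * (x * (1 - x)) = a * x * x' * (x - x').
Proof. by move=> -> ->; ring. Qed.

(** Here [i] is the coordinate that decreases from [(xi', xk')] to [(xi, xk)]
    and [k] another one.  The last two hypotheses say that the mass left over
    by [i] and [k] is nonnegative and does not decrease; this makes
    [(1 - xk') / (1 - xk)] at most [xi' / xi]. *)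
Lemma cross_bound (t t' xi xi' xk xk' : R) :
  0 <= t -> 0 < xi -> xi <= xi' -> 0 <= xk' ->
  t' * (xk * (1 - xk)) <= t * (xk' * (1 - xk')) ->
  0 <= 1 - xi - xk -> 1 - xi' - xk' <= 1 - xi - xk ->
  t' * (xk * xi) <= t * (xk' * xi').
Proof.
move=> t0 xi0 lexi xk'0 ineq e0 lee.
have xk1 : 0 < 1 - xk by lra.
rewrite -(ler_pM2r xk1).
have step1 : t' * (xk * (1 - xk)) * xi <= t * (xk' * (1 - xk')) * xi.
  by rewrite ler_wpM2r // ltW.
have step2 : (1 - xk') * xi <= xi' * (1 - xk).
  have : (1 - xi' - xk') * xi <= (1 - xi - xk) * xi' .
    apply: (@le_trans _ _ ((1 - xi - xk) * xi)).
      by rewrite ler_wpM2r // ltW.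
    by rewrite ler_wpM2l.
  by lra.
have tx0 : 0 <= t * xk' by rewrite mulr_ge0.
have := ler_wpM2l tx0 step2; lra.
Qed.

Section TwoSolutions.
Variables (I : finType) (a c s s' : I -> R) (t t' : R).
Hypotheses (a_gt0 : forall i, 0 < a i)
  (s_ge0 : forall i, 0 <= s i) (s'_ge0 : forall i, 0 <= s' i)
  (s_sum : \sum_i s i = 1) (s'_sum : \sum_i s' i = 1)
  (t_gt0 : 0 < t) (t'_ge0 : 0 <= t') (le_t't : t' <= t)
  (sE : forall i, t = a i * s i + c i * (s i * (1 - s i)))
  (s'E : forall i, t' = a i * s' i + c i * (s' i * (1 - s' i))).

Let sum2 (f : I -> R) i k : k != i ->
  \sum_j f j = f i + f k + \sum_(j | (j != i) && (j != k)) f j.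
Proof. by move=> ki; rewrite (bigD1 i) //= (bigD1 k) //= addrA. Qed.

Let s_gt0 i : 0 < s i.
Proof.
rewrite lt_def s_ge0 andbT; apply/eqP => si0.
by have := t_gt0; rewrite (sE i) si0 !(mul0r, mulr0) addr0 ltxx.
Qed.

Let decreasing_lt i : s i < s' i ->
  t * (s' i * (1 - s' i)) < t' * (s i * (1 - s i)).
Proof.
move=> lti; have s'i0 : 0 < s' i by apply: lt_trans lti.
have p0 : 0 < a i * s i * s' i by rewrite !mulr_gt0.
have := two_solutions (sE i) (s'E i).
have : a i * s i * s' i * (s i - s' i) < 0 by rewrite pmulr_rlt0 // subr_lt0.
lra.
Qed.

Let nondecreasing_le i : s' i <= s i ->
  t' * (s i * (1 - s i)) <= t * (s' i * (1 - s' i)).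
Proof.
move=> lei.
have p0 : 0 <= a i * s i * s' i by rewrite !mulr_ge0 // ltW.
have := two_solutions (sE i) (s'E i).
have : 0 <= a i * s i * s' i * (s i - s' i) by rewrite mulr_ge0 // subr_ge0.
lra.
Qed.

Let s'_le1 i : s' i <= 1.
Proof. by rewrite -s'_sum (bigD1 i) //= lerDl sumr_ge0. Qed.

(** [t'] being at most [t], the strict comparison at a decreasing coordinate
    gives [q(s'_i) < q(s_i)]: the two values lie on both sides of the axis of
    [q]. *)
Let decreasing_heavy i : s i < s' i -> 1 < s i + s' i.
Proof.
move=> lti; have lt1 := decreasing_lt lti.
have q'0 : 0 <= s' i * (1 - s' i) by rewrite mulr_ge0 // subr_ge0.
have le1 := ler_wpM2r q'0 le_t't.
rewrite ltNge; apply/negP => le_sum.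
have q_le : s i * (1 - s i) <= s' i * (1 - s' i).
  have := mulr_ge0 (_ : 0 <= s' i - s i) (_ : 0 <= 1 - s i - s' i).
  by lra.
have := ler_wpM2l t'_ge0 q_le; lra.
Qed.

Let no_decrease i : s' i <= s i.
Proof.
rewrite leNgt; apply/negP => lti.
have others k : k != i -> s' k <= s k.
  move=> ki; rewrite leNgt; apply/negP => ltk.
  (* two heavy coordinates would exceed the total mass 2 of both solutions *)
  have hi := decreasing_heavy lti; have hk := decreasing_heavy ltk.
  have := s_sum; have := s'_sum; rewrite !(sum2 _ ki).
  have := @sumr_ge0 R I (index_enum I) (fun j => (j != i) && (j != k)) s
    (fun j _ => s_ge0 j).
  have := @sumr_ge0 R I (index_enum I) (fun j => (j != i) && (j != k)) s'
    (fun j _ => s'_ge0 j).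
  lra.
have cross k : k != i -> t' * (s k * s i) <= t * (s' k * s' i).
  move=> ki; apply: cross_bound => //; try exact: ltW.
  - by apply: nondecreasing_le; apply: others.
  - rewrite -s_sum (sum2 _ ki).
    have := @sumr_ge0 R I (index_enum I) (fun j => (j != i) && (j != k)) s
      (fun j _ => s_ge0 j).
    lra.
  - rewrite -{1}s'_sum -s_sum !(sum2 _ ki).
    have : \sum_(j | (j != i) && (j != k)) s' j
           <= \sum_(j | (j != i) && (j != k)) s j.
      by apply: ler_sum => j /andP[ji _]; apply: others.
    lra.
have rest (f : I -> R) : \sum_j f j = 1 -> \sum_(j | j != i) f j = 1 - f i.
  by rewrite (bigD1 i) //= => <-; rewrite addrAC subrr add0r.
have : \sum_(k | k != i) t' * (s k * s i)
       <= \sum_(k | k != i) t * (s' k * s' i).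
  by apply: ler_sum.
rewrite -!mulr_sumr -!mulr_suml !rest //.
have := decreasing_lt lti; lra.
Qed.

Lemma ordered_simplex_solutions_eq i : s i = s' i.
Proof.
have sum0 : \sum_j (s j - s' j) = 0 by rewrite sumrB s_sum s'_sum subrr.
have d0 j : true -> 0 <= s j - s' j by rewrite subr_ge0.
by apply/eqP; rewrite -subr_eq0 (psumr_eq0P d0 sum0).
Qed.

End TwoSolutions.

(** At height zero the system can have several solutions: for three indices and
    [c i = - 2 a i], every permutation of [(1/2, 1/2, 0)] solves it with
    [t = 0].  One solution of positive height rules out all others. *)
Lemma simplex_solution_unique (I : finType) (a c s s' : I -> R) (t t' : R) :
  (forall i, 0 < a i) ->
  (forall i, 0 <= s i) -> (forall i, 0 <= s' i) ->
  \sum_i s i = 1 -> \sum_i s' i = 1 -> 0 < t -> 0 <= t' ->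
  (forall i, t = a i * s i + c i * (s i * (1 - s i))) ->
  (forall i, t' = a i * s' i + c i * (s' i * (1 - s' i))) ->
  s =1 s'.
Proof.
move=> a0 s0 s'0 s1 s'1 t0 t'0 sE s'E i.
have [le|lt] := leP t' t; first exact: ordered_simplex_solutions_eq sE s'E i.
apply/esym; apply: ordered_simplex_solutions_eq s'E sE i => //; last exact: ltW.
all: try exact: ltW.
exact: lt_trans lt.
Qed.

End SimplexUniqueness.

(** * The prism *)

Section PrismGeometry.
Context {R : realType} {n : nat}.
Implicit Types (a w : 'I_n.+1 -> R) (x p : 'rV[R]_n.+1) (i j : 'I_n.+1).

Lemma base_vertexE i j :
  base_vertex i 0 j = ((j != ord_max) && (j == i))%:R :> R.
Proof.
rewrite /base_vertex; have [->|iM] := eqVneq i ord_max.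
  by rewrite mxE; case: eqP.
by rewrite mxE eqxx /=; have [->|_] := eqVneq j i; rewrite ?iM ?andbF.
Qed.

Lemma verticalE j : (vertical : 'rV[R]_n.+1) 0 j = (j == ord_max)%:R.
Proof. by rewrite mxE eqxx. Qed.

Lemma top_vertexE a i j :
  top_vertex a i 0 j =
    if j == ord_max then a i else (j == i)%:R.
Proof.
rewrite mxE base_vertexE mxE verticalE.
by case: eqP => _ /=; rewrite ?mulr1 ?add0r // mulr0 addr0.
Qed.

(** The height of the prism as an affine function of the base point.  The last
    coordinate of [p] has coefficient zero. *)
Definition roof a p : R := a ord_max + \sum_i p 0 i * (a i - a ord_max).

Lemma roof_is_height a p : is_height a p (roof a p).
Proof.
exists (set_last p (roof a p)); split; last by rewrite mxE eqxx.
have roof_lift t : roof a (p + t *: vertical) = roof a p.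
  congr (_ + _); apply: eq_bigr => j _; rewrite !mxE eqxx /=.
  by have [->|_] := eqVneq j ord_max; rewrite ?subrr ?mulr0 // addr0.
apply/seteqP; split=> x.
  case=> xP [t xE]; apply/rowP => j; rewrite mxE.
  have [->|jM] := eqVneq j ord_max.
    by rewrite -(roof_lift t) -xE; exact: xP.
  by rewrite xE mxE mxE verticalE (negbTE jM) mulr0 addr0.
move=> ->.
have -> : set_last p (roof a p) = p + (roof a p - p 0 ord_max) *: vertical.
  apply/rowP => j; rewrite mxE [RHS]mxE [in RHS]mxE verticalE.
  have [->|jM] := eqVneq j ord_max; first by rewrite mulr1 addrC subrK.
  by rewrite mulr0 addr0.
split; last by exists (roof a p - p 0 ord_max).
rewrite /Pi_hyperplane /= -/(roof a _) roof_lift.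
by rewrite !mxE !eqxx mulr1 addrC subrK.
Qed.

(** A point with barycentric coordinates [s] in the base is below the convex
    combination of the [a i]; the coordinate of the vertex [B_n] is implicit in
    [p] and is recovered from the sum of [s]. *)
Lemma roof_barycentric a p (s : 'I_n.+1 -> R) :
  \sum_i s i = 1 -> (forall i, i != ord_max -> p 0 i = s i) ->
  roof a p = \sum_i s i * a i.
Proof.
move=> s1 ps.
have -> : roof a p = a ord_max + \sum_i s i * (a i - a ord_max).
  congr (_ + _); apply: eq_bigr => i _.
  by have [->|iM] := eqVneq i ord_max; rewrite ?subrr ?mulr0 // ps.
under eq_bigr do rewrite mulrBr.
by rewrite sumrB -mulr_suml s1 mul1r addrC subrK.
Qed.

Lemma base_barycenterE w j :
  j != ord_max -> base_barycenter w 0 j = w j.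
Proof.
move=> jM; rewrite summxE (bigD1 j) //= big1 ?addr0.
  by rewrite mxE base_vertexE jM eqxx mulr1.
by move=> i ij; rewrite mxE base_vertexE [j == i]eq_sym (negbTE ij) andbF mulr0.
Qed.

Lemma prism_ge0 a x i : (forall j, 0 <= a j) -> prism a x -> 0 <= x 0 i.
Proof.
move=> a0 [lam [mu [lam0 mu0 _ ->]]]; rewrite summxE sumr_ge0 // => j _.
rewrite mxE mxE [in X in _ + X]mxE base_vertexE top_vertexE.
rewrite addr_ge0 ?mulr_ge0 ?ler0n //.
by case: ifP; rewrite ?ler0n.
Qed.

(** * Coordinates on the simplex *)

(** The weights of a point of [V_n] with respect to the vertices
    [B_1, ..., B_(n-1), P_n] that span it. *)
Definition weight_of a x i : R :=
  if i == ord_max then x 0 ord_max / a ord_max else x 0 i.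

Lemma weight_of_sum a x : Vlast a x <-> \sum_i weight_of a x i = 1.
Proof.
rewrite /Vlast /= [in X in _ <-> X](bigD1 ord_max) //= {1}/weight_of eqxx addrC.
suff -> : \sum_(i | i != ord_max) weight_of a x i
          = \sum_(i | i != ord_max) x 0 i by [].
by apply: eq_bigr => i iM; rewrite /weight_of (negbTE iM).
Qed.

Lemma weight_of_inj a x y : a ord_max != 0 ->
  weight_of a x =1 weight_of a y -> x = y.
Proof.
move=> aM0 e; apply/rowP => i; have := e i; rewrite /weight_of.
by have [->|//] := eqVneq i ord_max; apply: mulIf; rewrite invr_eq0.
Qed.

(** The sign is chosen so that the term multiplied is [s (1 - s)], which is
    nonnegative on the simplex; the value [0] at the last index turns
    [x_n = a_n s_n] into an instance of the same equation. *)
Definition curvature w a i : R := if i == ord_max then 0 else - bcoef w a i.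

Lemma Vparab_weight w a x i : a ord_max != 0 ->
  (forall j, j != ord_max -> Vparab w a j x) ->
  x 0 ord_max = a i * weight_of a x i
    + curvature w a i * (weight_of a x i * (1 - weight_of a x i)).
Proof.
move=> aM0 parab; rewrite /weight_of /curvature.
have [->|iM] := eqVneq i ord_max; first by rewrite mul0r addr0 mulrC divfK.
by have := parab i iM; rewrite /Vparab /= => ->; ring.
Qed.

Lemma weight_of_ge0 a x i :
  (forall j, 0 < a j) -> prism a x -> 0 <= weight_of a x i.
Proof.
move=> a0 px; have x0 j : 0 <= x 0 j by apply: prism_ge0 px => k; apply: ltW.
by rewrite /weight_of; case: ifP => // _; rewrite divr_ge0 // ltW.
Qed.

(** A point of [V_n] is the barycenter of [B_1, ..., B_(n-1), P_n] with its
    weights. *)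
Lemma prism_weight_of a x : a ord_max != 0 ->
  (forall i, 0 <= weight_of a x i) -> \sum_i weight_of a x i = 1 -> prism a x.
Proof.
move=> aM0 s0 s1.
exists (fun i => if i == ord_max then 0 else weight_of a x i),
       (fun i => if i == ord_max then weight_of a x i else 0).
split=> [i|i||]; try by case: ifP.
  by rewrite -[RHS]s1; apply: eq_bigr => i _; case: ifP; rewrite ?add0r ?addr0.
apply/rowP => j; rewrite summxE (bigD1 j) //= big1 => [|i ij].
  rewrite addr0 mxE mxE [in X in _ + X]mxE base_vertexE top_vertexE eqxx.
  rewrite /weight_of; have [->|jM] := eqVneq j ord_max.
    by rewrite mul0r add0r divfK.
  by rewrite mulr1 mul0r addr0.
rewrite mxE mxE [in X in _ + X]mxE base_vertexE top_vertexE.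
rewrite [j == i]eq_sym (negbTE ij) andbF mulr0 add0r; have [jM|_] := eqVneq j ord_max.
  by rewrite -jM (negbTE ij) mul0r.
by rewrite mulr0.
Qed.

(** * The distinguished point *)

Section Means.
Variables (a w : 'I_n.+1 -> R).
Hypotheses (a_gt0 : forall i, 0 < a i) (w_gt0 : forall i, 0 < w i).

Lemma hmean_denom_gt0 : 0 < \sum_i (w i / a i).
Proof.
rewrite (bigD1 ord_max) //= ltr_wpDr ?divr_gt0 //.
by apply: sumr_ge0 => i _; rewrite ltW ?divr_gt0.
Qed.

Lemma hmean_gt0 : 0 < hmean w a.
Proof. by rewrite divr_gt0 // hmean_denom_gt0. Qed.

Lemma weight_of_xbar i : weight_of a (xbar w a) i = w i * (hmean w a / a i).
Proof.
rewrite /weight_of !mxE eqxx.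
by have [->|//] := eqVneq i ord_max; rewrite mulrA.
Qed.

Lemma weight_of_xbar_gt0 i : 0 < weight_of a (xbar w a) i.
Proof. by rewrite weight_of_xbar mulr_gt0 // divr_gt0 // hmean_gt0. Qed.

Lemma weight_of_xbar_sum : \sum_i weight_of a (xbar w a) i = 1.
Proof.
under eq_bigr do rewrite weight_of_xbar mulrCA.
by rewrite -mulr_sumr /hmean div1r mulVf // gt_eqF // hmean_denom_gt0.
Qed.

Lemma xbar_lt1 i : i != ord_max -> xbar w a 0 i < 1.
Proof.
move=> iM; rewrite -weight_of_xbar_sum (bigD1 i) //=.
rewrite {1}/weight_of (negbTE iM) ltrDl (bigD1 ord_max) 1?eq_sym //=.
rewrite ltr_wpDr ?weight_of_xbar_gt0 //.
by apply: sumr_ge0 => j _; rewrite ltW ?weight_of_xbar_gt0.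
Qed.

(** The coefficient [b_i] is the solution of this linear equation in it. *)
Lemma xbar_Vparab i : i != ord_max -> Vparab w a i (xbar w a).
Proof.
move=> iM; rewrite /Vparab /=.
have x1 := xbar_lt1 iM.
have x0 : 0 < xbar w a 0 i.
  by have := weight_of_xbar_gt0 i; rewrite /weight_of (negbTE iM).
have bE : bcoef w a i * (xbar w a 0 i * (xbar w a 0 i - 1))
          = hmean w a * (w ord_max - w i).
  by rewrite /bcoef mulrAC divfK // mulf_neq0 ?subr_eq0 ?(lt_eqF x1) // gt_eqF.
have aE : a i * xbar w a 0 i = w i * hmean w a.
  by rewrite mxE (negbTE iM) mulrCA [a i * _]mulrC divfK // gt_eqF.
have lE : xbar w a 0 ord_max = w ord_max * hmean w a by rewrite mxE eqxx.
have -> : bcoef w a i * xbar w a 0 i ^+ 2 + (a i - bcoef w a i) * xbar w a 0 i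
  = bcoef w a i * (xbar w a 0 i * (xbar w a 0 i - 1)) + a i * xbar w a 0 i.
  by ring.
by rewrite bE aE lE; ring.
Qed.

Lemma Vsystem_prism_unique : Vsystem w a `&` prism a = [set xbar w a].
Proof.
have aM0 : a ord_max != 0 by rewrite gt_eqF.
apply/seteqP; split=> [x [[xlast xparab] xprism]|x ->].
  apply/esym/(weight_of_inj aM0).
  apply: (simplex_solution_unique (a := a) (c := curvature w a)
            (t := xbar w a 0 ord_max) (t' := x 0 ord_max)) => //.
  - by move=> i; rewrite ltW ?weight_of_xbar_gt0.
  - by move=> i; apply: weight_of_ge0.
  - exact: weight_of_xbar_sum.
  - exact/weight_of_sum.
  - by rewrite mxE eqxx mulr_gt0 // hmean_gt0.
  - by apply: prism_ge0 xprism => j; apply: ltW.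
  - by move=> i; apply: Vparab_weight => // j; apply: xbar_Vparab.
  - by move=> i; apply: Vparab_weight.
split.
  by split; [exact/weight_of_sum/weight_of_xbar_sum|exact: xbar_Vparab].
apply: prism_weight_of weight_of_xbar_sum => // i.
by rewrite ltW ?weight_of_xbar_gt0.
Qed.

Hypothesis w_sum : \sum_i w i = 1.

Lemma roof_xbar t : roof a (set_last (xbar w a) t) = hmean w a.
Proof.
rewrite (roof_barycentric a weight_of_xbar_sum); last first.
  by move=> i iM; rewrite mxE /weight_of (negbTE iM).
transitivity (\sum_i w i * hmean w a); last by rewrite -mulr_suml w_sum mul1r.
by apply: eq_bigr => i _; rewrite weight_of_xbar -mulrA divfK // gt_eqF.
Qed.

End Means.

(** * Incidences of the vertices *)

Lemma top_vertex_Pi a i : Pi_hyperplane a (top_vertex a i).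
Proof.
rewrite /Pi_hyperplane /= top_vertexE eqxx -/(roof a _).
rewrite (@roof_barycentric _ _ (fun j => (j == i)%:R)).
- rewrite (bigD1 i) //= eqxx mul1r big1 ?addr0 // => j /negbTE->.
  by rewrite mul0r.
- by rewrite (bigD1 i) //= eqxx big1 ?addr0 // => j /negbTE->.
- by move=> j jM; rewrite top_vertexE (negbTE jM).
Qed.

Lemma base_vertex_Vlast a i : i != ord_max -> Vlast a (base_vertex i).
Proof.
move=> iM; rewrite /Vlast /= [X in _ + X / _]base_vertexE eqxx mul0r addr0.
rewrite (bigD1 i) //= big1 ?addr0 ?base_vertexE ?iM ?eqxx // => j /andP[_ ji].
by rewrite base_vertexE (negbTE ji) andbF.
Qed.

Lemma top_vertex_Vlast a : a ord_max != 0 -> Vlast a (top_vertex a ord_max).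
Proof.
move=> aM0; rewrite /Vlast /= [X in _ + X / _]top_vertexE eqxx divff //.
by rewrite big1 ?add0r // => j jM; rewrite top_vertexE (negbTE jM).
Qed.

Lemma top_vertex_Vparab w a i : i != ord_max -> Vparab w a i (top_vertex a i).
Proof.
move=> iM; rewrite /Vparab /= !top_vertexE !eqxx (negbTE iM).
by rewrite expr1n !mulr1 addrC subrK.
Qed.

Lemma base_vertex_Vparab w a i j :
  i != ord_max -> j != i -> Vparab w a i (base_vertex j).
Proof.
move=> iM ji; rewrite /Vparab /= !base_vertexE eqxx [i == j]eq_sym (negbTE ji).
by rewrite andbF expr2 !mulr0 addr0.
Qed.

End PrismGeometry.

Theorem theorem3 (R : realType) (n : nat) (hn : (2 <= n.+1)%N)
    (a w : 'I_n.+1 -> R)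
    (ha : forall i, 0 < a i) (hw : forall i, 0 < w i)
    (hw1 : \sum_i w i = 1) :
  [/\ (forall i, Pi_hyperplane a (top_vertex a i)),
      (forall i, i != ord_max -> Vlast a (base_vertex i))
        /\ Vlast a (top_vertex a ord_max)
    & (forall i, i != ord_max ->
        Vparab w a i (top_vertex a i) /\
        forall j, j != i -> Vparab w a i (base_vertex j))]
  /\ Vsystem w a `&` prism a = [set xbar w a]
  /\ (is_height a (set_last (xbar w a) 0) (hmean w a)
      /\ Pi_hyperplane a (set_last (xbar w a) (hmean w a)))
  /\ is_height a (base_barycenter w) (amean w a).
Proof.
have aM0 : a ord_max != 0 by rewrite gt_eqF.
split; [|split; [|split]].
- split; first exact: top_vertex_Pi.
    by split; [exact: base_vertex_Vlast|exact: top_vertex_Vlast].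
  move=> i iM; split; first exact: top_vertex_Vparab.
  by move=> j; apply: base_vertex_Vparab.
- exact: Vsystem_prism_unique.
- split.
    by rewrite -[hmean w a](roof_xbar ha hw hw1 0); exact: roof_is_height.
  by rewrite /Pi_hyperplane /= -/(roof a _) roof_xbar // mxE eqxx.
- have -> : amean w a = roof a (base_barycenter w).
    by rewrite (roof_barycentric a hw1) // => i; apply: base_barycenterE.
  exact: roof_is_height.
Qed.
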